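(* If $X$ is a first countable, locally compact, paracompact, Hausdorff space and $f:X\to X$ is a topologically Anosov homeomorphism, then $f$ is topologically stable.
   Context: Write $\Delta_X=\{(x,x):x\in X\}\subset X\times X$ and $F=f\times f:X\times X\to X\times X$. A neighborhood of $\Delta_X$ is a subset of $X\times X$ containing an open set that contains $\Delta_X$. A homeomorphism $f$ is (topologically) expansive if there is a closed neighborhood $N$ of $\Delta_X$ such that for any distinct $x,y\in X$ there exists $n\in\mathbb Z$ with $F^n(x,y)\notin N$. For a neighborhood $D$ of $\Delta_X$, a $D$-pseudo-orbit is a bi-infinite sequence $\{x_i\}_{i\in\mathbb Z}$ in $X$ with $(f(x_{i-1}),x_i)\in D$ for all $i$. For a neighborhood $E$ of $\Delta_X$, it is $E$-traced by $y\in X$ if $(f^i(y),x_i)\in E$ for all $i\in\mathbb Z$. $f$ has the (topological) shadowing property if for every neighborhood $E$ of $\Delta_X$ there is a neighborhood $D$ of $\Delta_X$ such that every $D$-pseudo-orbit is $E$-traced by some point of $X$. $f$ is topologically Anosov if it is expansive and has the shadowing property. $f$ is topologically stable if for any neighborhood $B$ of $\Delta_X$ there exists a neighborhood $D$ of $\Delta_X$ such that for any homeomorphism $g:X\to X$ satisfying $(f(x),g(x))\in D$ for all $x\in X$, there exists a continuous map $h:X\to X$ satisfying $(h(x),x)\in B$ for all $x\in X$ and $f\circ h=h\circ g$. *)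

(* Defs.v *)
From mathcomp Require Import all_boot all_order all_algebra.
From mathcomp Require Import all_classical all_analysis.

Set Implicit Arguments.
Unset Strict Implicit.
Unset Printing Implicit Defensive.

Import Order.TTheory GRing.Theory Num.Theory.
Local Open Scope classical_set_scope.
Local Open Scope ring_scope.

Definition first_countable (X : topologicalType) : Prop :=
  forall x : X, exists B : set (set X),
    [/\ countable B, B `<=` nbhs x &
        forall U, nbhs x U -> exists2 V, B V & V `<=` U].

(* Open covers are sets of open sets; no separation axiom is built in. *)
Definition paracompact (X : topologicalType) : Prop :=
  forall U : set (set X), U `<=` open -> \bigcup_(A in U) A = [set: X] ->
  exists V : set (set X),
    [/\ V `<=` open, \bigcup_(A in V) A = [set: X],
        forall A, V A -> exists2 B, U B & A `<=` B &
        forall x : X, exists2 W, nbhs x W &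
          finite_set [set A | V A /\ A `&` W !=set0]].

Record homeomorphism (X : topologicalType) := Homeomorphism {
  homeo_fun :> X -> X;
  homeo_inv : X -> X;
  homeo_funK : cancel homeo_fun homeo_inv;
  homeo_invK : cancel homeo_inv homeo_fun;
  homeo_fun_continuous : continuous homeo_fun;
  homeo_inv_continuous : continuous homeo_inv }.

(* [Negz m] is the integer -(m + 1). *)
Definition homeo_iter (X : topologicalType) (f : homeomorphism X) (n : int) :
    X -> X :=
  match n with
  | Posz m => iter m f
  | Negz m => iter m.+1 (homeo_inv f)
  end.

Definition map_square (X : Type) (f : X -> X) (p : X * X) : X * X :=
  (f p.1, f p.2).

Lemma map_square_continuous (X : topologicalType) (f : X -> X) :
  continuous f -> continuous (map_square f).
Proof.
move=> cf [x y]; apply: cvg_pair => /=.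
  exact: (cvg_comp fst f cvg_fst (cf x)).
exact: (cvg_comp snd f cvg_snd (cf y)).
Qed.

Lemma map_squareK (X : Type) (f g : X -> X) :
  cancel f g -> cancel (map_square f) (map_square g).
Proof. by move=> fK [x y]; rewrite /map_square /= !fK. Qed.

Definition homeo_square (X : topologicalType) (f : homeomorphism X) :
    homeomorphism (X * X)%type :=
  Homeomorphism (map_squareK (homeo_funK f)) (map_squareK (homeo_invK f))
    (map_square_continuous (@homeo_fun_continuous _ f))
    (map_square_continuous (@homeo_inv_continuous _ f)).

Definition diag_nbhs (X : topologicalType) (N : set (X * X)) : Prop :=
  exists U : set (X * X), [/\ open U, diagonal `<=` U & U `<=` N].

Lemma diag_nbhsE (X : topologicalType) (N : set (X * X)) :
  diag_nbhs N <-> set_nbhs diagonal N.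
Proof. by rewrite set_nbhsP. Qed.

Definition expansive (X : topologicalType) (f : homeomorphism X) : Prop :=
  exists N : set (X * X), [/\ closed N, diag_nbhs N &
    forall x y : X, x <> y ->
      exists n : int, ~ N (homeo_iter (homeo_square f) n (x, y))].

Definition pseudo_orbit (X : topologicalType) (f : homeomorphism X)
    (D : set (X * X)) (x : int -> X) : Prop :=
  forall i : int, D (f (x (i - 1)), x i).

Definition traced (X : topologicalType) (f : homeomorphism X)
    (E : set (X * X)) (x : int -> X) (y : X) : Prop :=
  forall i : int, E (homeo_iter f i y, x i).

Definition shadowing (X : topologicalType) (f : homeomorphism X) : Prop :=
  forall E : set (X * X), diag_nbhs E ->
  exists2 D : set (X * X), diag_nbhs D &
    forall x : int -> X, pseudo_orbit f D x -> exists y : X, traced f E x y.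

Definition topologically_Anosov (X : topologicalType) (f : homeomorphism X) :
    Prop :=
  expansive f /\ shadowing f.

Definition topologically_stable (X : topologicalType) (f : homeomorphism X) :
    Prop :=
  forall B : set (X * X), diag_nbhs B ->
  exists2 D : set (X * X), diag_nbhs D &
    forall g : homeomorphism X, (forall x : X, D (f x, g x)) ->
    exists h : X -> X, [/\ continuous h, forall x : X, B (h x, x) &
      f \o h = h \o g].

(* Main.v *)
(** Paracompactness and regularity give a locally finite open cover [V] together
    with open sets [U A] containing [closure A], for [A] in [V], that are
    relatively compact and whose squares lie in [N] and in [B], where [N] is an
    expansivity neighborhood and [B] the required precision.  The relation
    "[y] is in [U A] whenever [A] contains [x]" is then a neighborhood [E] of
    the diagonal.  Tracing the [g]-orbit of [x] with precision [E] defines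
    [h x]; two tracing points have orbits that stay [N]-close, so [h x] is unique
    and [h] is a semiconjugacy.  Near [x], [h] has values in a compact set, and
    since [N] is closed every cluster point of [h] at [x] stays [N]-close to
    [h x], hence equals it; so [h] is continuous. *)
Require Import Defs.
From mathcomp Require Import all_boot all_order all_algebra finmap.
From mathcomp Require Import all_classical all_analysis.
Local Open Scope classical_set_scope.

Lemma diag_nbhsP (X : topologicalType) (N : set (X * X)) :
  diag_nbhs N <-> forall x : X, nbhs (x, x) N.
Proof.
rewrite diag_nbhsE; split=> [N_nbhs x|N_nbhs]; first exact: N_nbhs.
by move=> [x y] xy; rewrite (_ : x = y).
Qed.

(** With [K] a compact neighborhood of [x], the interior of [W] meet [K] serves as [U]; regularity
    of compact Hausdorff sets then gives [O]. *)
Lemma locally_compact_nbhs_closure {X : topologicalType} {x : X} {W : set X} :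
  locally_compact [set: X] -> hausdorff_space X -> nbhs x W ->
  exists O U : set X, [/\ open O, O x, open U, closure O `<=` U &
    U `<=` W /\ precompact U].
Proof.
move=> lcX hX xW; have [K + [cptK clK]] := lcX x I; rewrite withinET => xK.
have xU : nbhs x (interior (W `&` K)).
  by apply: open_nbhs_nbhs; split; [exact: open_interior|exact: filterI].
have [P xP PU] := compact_regular hX cptK xK xU.
exists (interior P), (interior (W `&` K)).
split; [exact: open_interior|exact: xP|exact: open_interior| |].
  by apply: subset_trans PU; apply: closure_subset; exact: interior_subset.
split=> [y /interior_subset[]//|].
by exists K => // y /interior_subset[].
Qed.

(** Refining the cover by the sets [O] of good pairs preserves the inclusion of closures in [U]. *)
Lemma fine_locally_finite_cover {X : topologicalType} {M : set (X * X)} :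
  locally_compact [set: X] -> paracompact X -> hausdorff_space X ->
  diag_nbhs M ->
  exists (V : set (set X)) (U : set X -> set X),
    [/\ V `<=` open, \bigcup_(A in V) A = [set: X],
        forall A, V A ->
          [/\ open (U A), A `<=` U A, precompact (U A) & U A `*` U A `<=` M] &
        diag_nbhs [set p | forall A, V A -> A p.2 -> U A p.1]].
Proof.
move=> lcX pcX hX /diag_nbhsP M_nbhs.
pose good (O U : set X) :=
  [/\ open U, closure O `<=` U, precompact U & U `*` U `<=` M].
have [| |V [V_open V_cover V_refine V_lf]] :=
    pcX [set O | open O /\ exists U, good O U].
- by move=> O [].
- apply/seteqP; split=> // x _; have [[P Q] /= [xP xQ] PQM] := M_nbhs x.
  have [ O [U [oO Ox oU OU [UW pU]]]] :=
    locally_compact_nbhs_closure lcX hX (filterI xP xQ).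
  exists O => //; split=> //; exists U; split=> // -[y z] /= [Uy Uz].
  by apply: PQM; split; [have [] := UW _ Uy|have [] := UW _ Uz].
have /choice[U U_good] (A : set X) : exists U, V A -> good A U.
  have [VA|nVA] := pselect (V A); last by exists set0.
  have [ O [_ [U [oU OU pU UM]]] AO] := V_refine _ VA.
  by exists U => _; split=> //; apply: subset_trans OU; exact: closure_subset.
exists V, U; split=> //.
  move=> A VA; have [oU AU pU UM] := U_good _ VA; split=> //.
  exact: subset_trans (@subset_closure _ _) AU.
apply/diag_nbhsP => x; have [W xW /finite_fsetP[S S_def]] := V_lf x.
pose G (A : set X) := [set p : X * X | A p.2 -> U A p.1].
have S_nbhs : nbhs (x, x) (\bigcap_(A in [set` S]) G A).
  apply: filter_bigI => A AS.
  have [VA _] : [set A | V A /\ A `&` W !=set0] A by rewrite S_def.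
  have [oU AU _ _] := U_good _ VA.
  (* Either [U A] is a neighborhood of [x], or points near [x] avoid [A] and the condition is
     vacuous. *)
  have [cAx|ncAx] := pselect (closure A x).
    exists (U A, setT) => /=; last by move=> [y z] [Uy _].
    split; last exact: filterT.
    by apply: open_nbhs_nbhs; split=> //; exact: AU.
  exists (setT, ~` closure A) => /=.
    split; first exact: filterT.
    by apply: open_nbhs_nbhs; split=> //; apply: closed_openC; exact: closed_closure.
  by move=> [y z] [_ /= ncAz] /subset_closure.
have W_nbhs : nbhs (x, x) [set p : X * X | W p.2].
  by exists (setT, W); [split=> //; exact: filterT|move=> [y z] []].
apply: filterS (filterI S_nbhs W_nbhs) => -[y z] /= [Gyz Wz] A VA Az.
apply: (Gyz A) => //.
suff : [set A | V A /\ A `&` W !=set0] A by rewrite S_def.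
by split=> //; exists z.
Qed.

Section HomeoIter.
Variables (X : topologicalType) (f : homeomorphism X).
Local Open Scope ring_scope.
Import GRing.Theory.

Lemma homeo_iter_continuous n : continuous (homeo_iter f n).
Proof.
have iter_cont (g : X -> X) m : continuous g -> continuous (iter m g).
  move=> cg; elim: m => [|m IH] x; first exact: cvg_id.
  by apply: (continuous_comp (IH x)); exact: cg.
case: n => m; apply: iter_cont.
  exact: homeo_fun_continuous.
exact: homeo_inv_continuous.
Qed.

Lemma NegzS_add1 m : Negz m.+1 + 1 = Negz m.
Proof. by rewrite !NegzE -[m.+2]addn1 PoszD opprD addrNK. Qed.

Lemma homeo_iterS n x : homeo_iter f (n + 1) x = f (homeo_iter f n x).
Proof.
case: n => [m|[|m]]; first by rewrite /= addn1.
  by rewrite /= homeo_invK.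
by rewrite NegzS_add1 [in RHS]/= homeo_invK.
Qed.

Lemma homeo_iterSr n x : homeo_iter f (n + 1) x = homeo_iter f n (f x).
Proof.
case: n => [m|[|m]]; first by rewrite /= addn1; exact: iterSr.
  by rewrite /= homeo_funK.
by rewrite NegzS_add1 [RHS]iterSr homeo_funK.
Qed.

Lemma homeo_iter_square n x y :
  homeo_iter (homeo_square f) n (x, y) = (homeo_iter f n x, homeo_iter f n y).
Proof.
have iter_square (g : X -> X) m :
    iter m (map_square g) (x, y) = (iter m g x, iter m g y).
  by elim: m => //= m ->.
by case: n => m; rewrite [LHS]iter_square.
Qed.

End HomeoIter.

Theorem theorem22 (X : topologicalType) (f : homeomorphism X)
    (X_first_countable : first_countable X)
    (X_locally_compact : locally_compact [set: X])
    (X_paracompact : paracompact X)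
    (X_hausdorff : hausdorff_space X)
    (f_Anosov : topologically_Anosov f) :
  topologically_stable f.
Proof.
have [[N [N_closed N_nbhs f_expansive]] f_shadowing] := f_Anosov.
move=> B B_nbhs.
have NB_nbhs : diag_nbhs (N `&` B).
  apply/diag_nbhsP => x.
  by apply: filterI; move: x; apply/diag_nbhsP.
have [V [U [V_open V_cover V_U E_nbhs]]] :=
  fine_locally_finite_cover X_locally_compact X_paracompact X_hausdorff NB_nbhs.
have coverP x : exists2 A, V A & A x.
  by suff [A VA Ax] : (\bigcup_(A in V) A) x; [exists A|rewrite V_cover].
have N_close_eq y z :
    (forall n, N (homeo_iter f n y, homeo_iter f n z)) -> y = z.
  move=> Nyz; apply: contrapT => /f_expansive[n].
  by rewrite homeo_iter_square; apply.
pose E := [set p : X * X | forall A, V A -> A p.2 -> U A p.1].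
have [D D_nbhs D_traced] := f_shadowing E E_nbhs.
exists D => // g Dfg.
have [x|h h_traced] :=
    @choice _ _ (fun x y => traced f E (fun i => homeo_iter g i x) y).
  (* Each [g]-orbit is a [D]-pseudo-orbit of [f], as [g] is [D]-close to [f]. *)
  apply: D_traced => i; rewrite /= -{2}(GRing.subrK 1%R i) homeo_iterS.
  exact: Dfg.
(* It is enough that [z] traces in the closed sense: the limits of tracing points
   only satisfy this weaker condition. *)
have h_unique x z :
    (forall n A, V A -> A (homeo_iter g n x) ->
      closure (U A) (homeo_iter f n z)) -> z = h x.
  move=> z_close; apply: N_close_eq => n.
  have [A VA Agx] := coverP (homeo_iter g n x).
  have UAh : U A (homeo_iter f n (h x)) by exact: h_traced Agx.
  (* As [N] is closed, it suffices to move the first coordinate slightly into [U A]. *)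
  rewrite (closure_id N).1// => W [[P Q] /= [zP hQ] PQW].
  have [w [UAw Pw]] := z_close _ _ VA Agx _ zP.
  exists (w, homeo_iter f n (h x)); split.
    by have [_ _ _ /(_ (w, homeo_iter f n (h x)))[]] := V_U _ VA.
  by apply: PQW; split=> //=; exact: nbhs_singleton.
exists h; split.
- move=> x; have [A VA Ax] := coverP x; have [oU AU [K UK [cptK _]] _] := V_U _ VA.
  have hxUA y : A y -> U A (h y) by move=> Ay; exact: (h_traced y 0%R A VA Ay).
  have hxK : (h @ x) K.
    by apply: filterS (open_nbhs_nbhs (conj (V_open _ VA) Ax)) => y /hxUA/UK.
  have cluster_eq z : cluster (h @ x) z -> z = h x.
    (* For fixed [n], continuity yields [y] near [x] with [g^n y] in [A'] and [f^n (h y)] in [W];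
       tracing puts the latter in [U A']. *)
    move=> hz; apply: h_unique => n A' VA' A'gx W zW.
    have gA' : nbhs x (homeo_iter g n @^-1` A').
      apply: homeo_iter_continuous.
      exact: open_nbhs_nbhs (conj (V_open _ VA') A'gx).
    have fW : nbhs z (homeo_iter f n @^-1` W) by exact: homeo_iter_continuous.
    have h_gA' : (h @ x) (h @` (homeo_iter g n @^-1` A')).
      by apply: filterS gA' => y A'gy; exists y.
    have [_ [[y A'gy <-] Wfhy]] := hz _ _ h_gA' fW.
    by exists (homeo_iter f n (h y)); split=> //; exact: h_traced A'gy.
  have h_cluster : cluster (h @ x) (h x).
    by have [z [_ hz]] := cptK _ _ hxK; rewrite -(cluster_eq z).
  (* A filter living in a compact set converges to its only cluster point. *)
  apply: (compact_cluster_set1 X_hausdorff cptK _ _ hxK).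
    exact: filterS UK (open_nbhs_nbhs (conj oU (hxUA _ Ax))).
  by apply/seteqP; split=> [z /cluster_eq|z ->].
- move=> x; have [A VA Ax] := coverP x; have [_ AU _ UM] := V_U _ VA.
  have UAh : U A (h x) by exact: (h_traced x 0%R A VA Ax).
  by have [] := UM (h x, x) (conj UAh (AU _ Ax)).
(* By a shift of index, [f (h x)] traces the [g]-orbit of [g x], so it is [h (g x)]. *)
- apply/funext => x /=; apply: h_unique => n A VA.
  rewrite -!homeo_iterSr => Agx; apply: subset_closure.
  exact: h_traced Agx.
Qed.
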